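(* Let $\Omega\subset\mathbb R^d$, $d\le 3$, be a bounded Lipschitz domain with boundary $\partial\Omega=\partial\Omega_1\cup\partial\Omega_2\cup\partial\Omega_3$, let $\delta>0$, let $\epsilon\in L^\infty(\Omega)$ satisfy $0<\epsilon_0\le\epsilon(x)\le\epsilon_1<\infty$ for a.e. $x\in\Omega$, and let the Dirichlet data $f_1$ on $\partial\Omega_2$ and $f_2$ on $\partial\Omega_3$ be fixed and admit a lifting $g\in H^1(\Omega)$, i.e. $g|_{\partial\Omega_2}=f_1$ and $g|_{\partial\Omega_3}=f_2$. Then there exists a constant $\eta=\eta(\epsilon_0,k_P)$, depending only on $\epsilon_0$ and the Poincaré constant $k_P$, such that for all $c_1,c_2\in L^2(\Omega)$, if $u_1,u_2\in H^1(\Omega)$ denote the weak solutions of $$-\nabla\cdot(\epsilon\nabla u)+2\delta^2\sinh(u)=c\ \text{ in }\Omega,\qquad \nabla u\cdot\boldsymbol n=0\ \text{ on }\partial\Omega_1,\qquad u=f_1\ \text{ on }\partial\Omega_2,\qquad u=f_2\ \text{ on }\partial\Omega_3$$ corresponding to $c=c_1$ and $c=c_2$ respectively, then $$\|u_1-u_2\|_{H^1(\Omega)}\le\eta\,\|c_1-c_2\|_{L^2(\Omega)}.$$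
   Context: Let $V_0=\{v\in H^1(\Omega): v=0\text{ on }\partial\Omega_2\cup\partial\Omega_3\}$ (in the sense of traces). A weak solution of the boundary value problem for a given $c\in L^2(\Omega)$ is a function $u\in H^1(\Omega)$ with $u-g\in V_0$ such that for all $v\in V_0$ (with all integrals well defined, in particular $\sinh(u)v\in L^1(\Omega)$) $$\int_\Omega\epsilon\nabla u\cdot\nabla v\,dx+2\delta^2\int_\Omega\sinh(u)\,v\,dx=\int_\Omega c\,v\,dx.$$ The Poincaré constant $k_P$ is a constant such that $\|v\|_{L^2(\Omega)}\le k_P\|\nabla v\|_{L^2(\Omega)}$ for all $v\in V_0$; the Dirichlet part $\partial\Omega_2\cup\partial\Omega_3$ of the boundary is such that this inequality holds. The norm is $\|v\|_{H^1(\Omega)}^2=\|v\|_{L^2(\Omega)}^2+\|\nabla v\|_{L^2(\Omega)}^2$. *)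

(* Defs.v *)
From HB Require Import structures.
From mathcomp Require Import all_boot all_order all_algebra.
From mathcomp Require Import all_classical all_reals all_analysis.

Set Implicit Arguments.
Unset Strict Implicit.
Unset Printing Implicit Defensive.

Import Order.TTheory GRing.Theory Num.Theory.
Import numFieldNormedType.Exports.

Local Open Scope classical_set_scope.
Local Open Scope ring_scope.

(* The sigma-algebra on R^n generated by the coordinate maps, that is, the
   Borel sigma-algebra. *)
Definition rV_display : measure_display. Proof. exact: default_measure_display. Qed.

Section measurable_rV.
Variables (R : realType) (n : nat).

Definition rV_coord (i : 'I_n) (x : 'rV[R]_n) : R := x ord0 i.

Let rV_set0 : g_sigma_preimage rV_coord set0.
Proof. exact: sigma_algebra0. Qed.

Let rV_setC A : g_sigma_preimage rV_coord A -> g_sigma_preimage rV_coord (~` A).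
Proof. exact: sigma_algebraC. Qed.

Let rV_bigcup (F : (set 'rV[R]_n)^nat) :
  (forall i, g_sigma_preimage rV_coord (F i)) ->
  g_sigma_preimage rV_coord (\bigcup_i F i).
Proof. exact: sigma_algebra_bigcup. Qed.

HB.instance Definition _ := @isMeasurable.Build rV_display 'rV[R]_n
  (g_sigma_preimage rV_coord) rV_set0 rV_setC rV_bigcup.

End measurable_rV.

Lemma measurable_rV_coord (R : realType) n (i : 'I_n) :
  measurable_fun [set: 'rV[R]_n] (@rV_coord R n i).
Proof.
move=> _ Y mY; rewrite setTI; apply: sub_sigma_algebra => /=.
rewrite -bigcup_seq/=; exists i => /=; first by rewrite mem_index_enum.
by exists Y => //; rewrite setTI.
Qed.

Lemma measurable_fun_rV d (T : measurableType d) (R : realType) n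
    (f : T -> 'rV[R]_n) :
  (forall i, measurable_fun [set: T] (@rV_coord R n i \o f)) ->
  measurable_fun [set: T] f.
Proof.
move=> mf _ A mA; rewrite setTI.
suff : g_sigma_preimage (@rV_coord R n) `<=` [set B | measurable (f @^-1` B)].
  exact.
apply: smallest_sub.
  split => /=.
  - by rewrite preimage_set0.
  - by move=> B mB; rewrite setTD preimage_setC; exact: measurableC.
  - by move=> F mF; rewrite preimage_bigcup; exact: bigcupT_measurable.
move=> B; rewrite -bigcup_seq /= => -[i _ [C mC <-]] /=.
by rewrite setTI -comp_preimage -[X in measurable X]setTI; exact: mf.
Qed.

(* Lebesgue measure on R^n: the image of the product of n copies of
   Lebesgue measure on R, obtained one coordinate at a time. *)
Section lebesgue_rV.
Variable R : realType.

Definition rV_cons n (p : measurableTypeR R * 'rV[R]_n) : 'rV[R]_n.+1 :=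
  row_mx (p.1 : R)%:M p.2.

Lemma measurable_rV_cons n : measurable_fun setT (@rV_cons n).
Proof.
apply: measurable_fun_rV => i; rewrite -[n.+1]/(1 + n)%N in i *.
case: (split_ordP i) => j ->.
  rewrite (_ : _ \o _ = fst) ?ord1 //.
  by apply/funext => p; rewrite /= /rV_coord /rV_cons row_mxEl ord1 mxE eqxx mulr1n.
rewrite (_ : _ \o _ = @rV_coord R n j \o snd).
  apply: measurableT_comp; [exact: measurable_rV_coord|exact: measurable_snd].
by apply/funext => p; rewrite /= /rV_coord /rV_cons row_mxEr.
Qed.

Section succ.
Variables (n : nat) (mu : {measure set 'rV[R]_n -> \bar R}).
Local Open Scope ereal_scope.

Definition lebesgue_rV_succ : set 'rV[R]_n.+1 -> \bar R :=
  pushforward (@lebesgue_measure R \x^ mu) (@rV_cons n).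

Let m0 : lebesgue_rV_succ set0 = 0.
Proof. by rewrite /lebesgue_rV_succ /pushforward preimage_set0 measure0. Qed.

Let m_ge0 A : 0 <= lebesgue_rV_succ A.
Proof. by rewrite /lebesgue_rV_succ /pushforward measure_ge0. Qed.

Let m_sigma_additive : semi_sigma_additive lebesgue_rV_succ.
Proof.
exact: (measure_semi_sigma_additive
  (s := measure_function_pushforward__canonical__measure_function_Measure _
          (@measurable_rV_cons n))).
Qed.

HB.instance Definition _ := isMeasure.Build _ _ _
  lebesgue_rV_succ m0 m_ge0 m_sigma_additive.

End succ.

Fixpoint lebesgue_rV n : {measure set 'rV[R]_n -> \bar R} :=
  match n with
  | 0 => \d_ (0 : 'rV[R]_0)
  | m.+1 => lebesgue_rV_succ (lebesgue_rV m)
  end.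

End lebesgue_rV.

(* Mathcomp's norm on 'rV[R]_n is the sup norm; diameters need the Euclidean
   one. *)
Definition enorm (R : realType) n (x : 'rV[R]_n) : R :=
  Num.sqrt (\sum_(i < n) x ord0 i ^+ 2).

Section hausdorff.
Variables (R : realType) (n : nat).
Implicit Types A : set 'rV[R]_n.
Local Open Scope ereal_scope.

Definition diam A : \bar R :=
  ereal_sup [set (enorm (x - y))%:E | x in A & y in A].

(* The empty set has weight 0 also for s = 0, so that s = 0 gives the counting
   measure. *)
Definition hausdorff_weight (s : nat) (delta : R) A : \bar R :=
  if A == set0 then 0
  else if diam A <= delta%:E then diam A ^+ s else +oo.

(* The s-dimensional Hausdorff outer measure, without the normalising constant
   vol(B^s) / 2^s; it is a measure on the Borel sets. [mu_ext] takes the infimum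
   over countable covers by Borel sets, which gives the same value as arbitrary
   covers because a set and its closure have the same diameter. *)
Definition hausdorff (s : nat) A : \bar R :=
  ereal_sup [set mu_ext (hausdorff_weight s delta) A
            | delta in [set delta : R | (0 < delta)%R]].

End hausdorff.

(* Surface measure in R^n, up to a positive constant factor, which matters
   neither for null sets nor for L^2-convergence on the boundary. *)
Definition surface (R : realType) n : set 'rV[R]_n -> \bar R :=
  @hausdorff R n n.-1.

Definition boundary (T : topologicalType) (A : set T) : set T :=
  closure A `\` interior A.

Section lipschitz_domain.
Variables (R : realType) (d : nat).

(* Near every boundary point, in suitable orthonormal coordinates [x *m Q], the
   set is the region above the graph of a Lipschitz function; the vertical
   coordinate is the first one. *)
Definition lipschitz_boundary (Omega : set 'rV[R]_d.+1) : Prop :=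
  forall x0, boundary Omega x0 ->
  exists (Q : 'M[R]_d.+1) (gamma : 'rV[R]_d -> R) (k r : R),
    [/\ Q *m Q^T = 1%:M, k.-lipschitz gamma, 0 < r &
        forall x, ball x0 r x ->
          let y := x *m Q in
          Omega x <-> gamma (\row_(i < d) y ord0 (lift ord0 i)) < y ord0 ord0].

Definition bounded_lipschitz_domain (Omega : set 'rV[R]_d.+1) : Prop :=
  [/\ Omega !=set0, open Omega, connected Omega, bounded_set Omega &
      lipschitz_boundary Omega].

End lipschitz_domain.

Section sobolev.
Variables (R : realType) (n : nat).
Local Notation T := 'rV[R]_n.
Local Notation leb := (lebesgue_rV R n).
Local Notation sigma := (@surface R n).
Implicit Types (Omega Gamma : set T) (u v w phi : T -> R) (Du Dv : T -> T).

Definition partial (i : 'I_n) phi : T -> R :=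
  fun x => 'D_(delta_mx ord0 i) phi x.

Definition grad phi : T -> T := fun x => \row_i partial i phi x.

Definition smooth phi : Prop := forall s : seq 'I_n,
  let psi := foldr partial phi s in
  continuous psi /\ forall i x, derivable psi x (delta_mx ord0 i).

Definition test_function Omega phi : Prop :=
  smooth phi /\
  exists K : set T, [/\ compact K, K `<=` Omega & forall x, ~ K x -> phi x = 0].

Definition L2 Omega u : Prop :=
  measurable_fun Omega u /\ leb.-integrable Omega (fun x => (u x ^+ 2)%:E).

Definition L2norm Omega u : R :=
  Num.sqrt (\int[leb]_(x in Omega) (u x ^+ 2))%R.

Definition dot (x y : T) : R := \sum_(i < n) x ord0 i * y ord0 i.

Definition weak_gradient Omega u Du : Prop :=
  forall phi, test_function Omega phi -> forall i : 'I_n,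
    (\int[leb]_(x in Omega) (u x * partial i phi x) =
     - \int[leb]_(x in Omega) (Du x ord0 i * phi x))%R.

(* Elements of H^1(Omega) are handled as pairs of a function and a weak gradient
   of it, the latter being unique up to a null set. *)
Definition H1 Omega u Du : Prop :=
  [/\ L2 Omega u, forall i, L2 Omega (fun x => Du x ord0 i) &
      weak_gradient Omega u Du].

(* The L^2-norm of a vector field. *)
Definition vL2norm Omega Du : R := L2norm Omega (fun x => enorm (Du x)).

Definition H1norm Omega u Du : R :=
  Num.sqrt (L2norm Omega u ^+ 2 + vL2norm Omega Du ^+ 2).

(* [w] is the trace of [u]: the trace operator is the continuous extension to
   H^1(Omega) of the restriction to the boundary of functions that are smooth up
   to the boundary, with values in L^2 of the boundary. *)
Definition is_trace Omega u Du w : Prop :=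
  [/\ measurable_fun (boundary Omega) w,
      (\int[sigma]_(x in boundary Omega) (w x ^+ 2)%:E < +oo)%E &
      exists phi : (T -> R)^nat,
      [/\ forall k, smooth (phi k),
          (\int[leb]_(x in Omega)
             ((phi k x - u x) ^+ 2 + enorm (grad (phi k) x - Du x) ^+ 2)%:E)%E
            @[k --> \oo] --> 0%E &
          (\int[sigma]_(x in boundary Omega) ((phi k x - w x) ^+ 2)%:E)%E
            @[k --> \oo] --> 0%E]].

(* u = f on the part Gamma of the boundary, in the sense of traces. *)
Definition trace_eq Omega Gamma u Du f : Prop :=
  exists2 w, is_trace Omega u Du w & {ae sigma, forall x, Gamma x -> w x = f x}.

(* H^1-functions vanishing on Gamma. *)
Definition V0 Omega Gamma v Dv : Prop :=
  H1 Omega v Dv /\ trace_eq Omega Gamma v Dv (cst 0).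

Definition poincare_constant Omega Gamma (kP : R) : Prop :=
  forall v Dv, V0 Omega Gamma v Dv -> L2norm Omega v <= kP * vL2norm Omega Dv.

Definition sinh (x : R) : R := (expR x - expR (- x)) / 2.

(* The remaining integrals exist by the Cauchy-Schwarz inequality when [eps] is
   bounded and [c] is in L^2. *)
Definition weak_solution Omega Gamma (eps : T -> R) (delta : R)
    (g : T -> R) (Dg : T -> T) (c : T -> R) u Du : Prop :=
  [/\ H1 Omega u Du,
      V0 Omega Gamma (fun x => u x - g x) (fun x => Du x - Dg x) &
      forall v Dv, V0 Omega Gamma v Dv ->
        leb.-integrable Omega (fun x => (sinh (u x) * v x)%:E) /\
        (\int[leb]_(x in Omega) (eps x * dot (Du x) (Dv x)) +
         2 * delta ^+ 2 * \int[leb]_(x in Omega) (sinh (u x) * v x) =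
         \int[leb]_(x in Omega) (c x * v x))%R].

End sobolev.

(* Main.v *)
(** Testing the two weak formulations with [v = u1 - u2] and subtracting them,
    the [sinh] term is nonnegative by monotonicity, so
    [eps0 * |Dv|^2 <= \int (c1 - c2) v]; Young's and Poincare's inequalities then
    bound [|Dv|] and [|v|].  The difference [v] is admissible because the space
    [V0] is closed under subtraction.  On the boundary the surface measure is
    only known to be an outer measure, for which the integral is not additive;
    there, [(a - b)^2 <= 4 max(a^2, b^2)] together with
    [\int max(f, g) <= \int f + \int g] replaces the triangle inequality. *)

Require Import Defs.
From HB Require Import structures.
From mathcomp Require Import all_boot all_order all_algebra.
From mathcomp Require Import all_classical all_reals all_analysis.
From mathcomp Require Import measurable_realfun ring lra.

Import Order.TTheory GRing.Theory Num.Theory.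
Import numFieldNormedType.Exports.

Local Open Scope classical_set_scope.
Local Open Scope ring_scope.

(** * Borel and Lebesgue structure of R^n *)

Lemma ler_coord_norm {R : realType} {n : nat} (x : 'rV[R]_n) i :
  `|x ord0 i| <= `|x|.
Proof.
by rewrite [leRHS]/Num.norm/= mx_normrE; apply/bigmax_geP; right; exists (ord0, i).
Qed.

Section borel_rV.
Context {R : realType} {n : nat}.
Implicit Types A : set 'rV[R]_n.

(** In the sup norm a ball is a finite intersection of preimages of intervals under the coordinate
    maps. *)
Lemma measurable_rV_ball (x : 'rV[R]_n) (e : R) : measurable (ball x e).
Proof.
(* Membership in a ball of row vectors includes [0 < e], so a nonpositive radius gives the empty
   set. *)
have [e_gt0|e_le0] := ltP 0 e; last first.
  by rewrite [X in measurable X](_ : _ = set0) // -subset0 => y [/lt_geF]; rewrite e_le0.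
rewrite (_ : ball x e = \bigcap_(i in [set: 'I_n])
    (@rV_coord R n i @^-1` ball (x ord0 i) e)).
  apply: fin_bigcap_measurable => [|i _]; first exact: finite_finset.
  rewrite -[X in measurable X]setTI; apply: measurable_rV_coord => //.
  by apply: open_measurable; exact: ball_open.
apply/seteqP; split => [y [_ xy] i _|y xy]; first exact: xy.
by split => // i j; rewrite ord1; exact: xy.
Qed.

(** The sigma-algebra is generated by coordinates, not by open sets; the link is that an open set is
    the countable union of the balls inside it with rational centre and radius [1 / (m + 1)]. *)
Lemma open_measurable_rV A : open A -> measurable A.
Proof.
move=> oA.
pose B (p : 'rV[rat]_n * nat) : set 'rV[R]_n :=
  ball (map_mx (ratr : rat -> R) p.1 : 'rV[R]_n) (p.2.+1%:R^-1 : R).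
rewrite (_ : A = \bigcup_(p in [set p | B p `<=` A]) B p); last first.
  apply/seteqP; split => [x Ax|x [p /= pA]]; last exact: pA.
  have /nbhs_ballP[e /= e_gt0 eA] : nbhs x A by exact: open_nbhs_nbhs.
  (* With a radius below [e / 2], every point of a rational ball containing [x] is within [e] of
     [x], so this ball stays inside [A]. *)
  have [m me] : exists m : nat, m.+1%:R^-1 < e / 2.
    have e2_gt0 : 0 < e / 2 by rewrite divr_gt0.
    have [m _ /(_ m (leqnn m)) /= me] := near_infty_natSinv_lt (PosNum e2_gt0).
    by exists m.
  have /choice[q qx] : forall i, exists q : rat,
      ball (x ord0 i) (m.+1%:R^-1 : R) (ratr q : R).
    move=> i; have m_gt0 : 0 < m.+1%:R^-1 :> R by rewrite invr_gt0.
    have /rat_in_itvoo[q q_] :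
      x ord0 i - m.+1%:R^-1 < x ord0 i + m.+1%:R^-1.
      by rewrite ltrD2l gtrN.
    by exists q; move: q_; rewrite in_itv/= /ball/= ltr_distlC.
  have Bx : ball (map_mx (ratr : rat -> R) (\row_i q i) : 'rV[R]_n) (m.+1%:R^-1 : R) x.
    split; first by rewrite invr_gt0.
    by move=> i j; rewrite ord1 !mxE; apply: ball_sym; exact: qx.
  exists (\row_i q i, m) => //=; apply: subset_trans eA => y Bqy.
  rewrite (splitr e); apply: le_ball (ball_triangle (ball_sym Bx) Bqy).
  by rewrite lerD// ltW.
rewrite bigcup_mkcond; apply: countable_bigcupT_measurable => // p.
by case: ifP => // _; exact: measurable_rV_ball.
Qed.

Lemma closed_measurable_rV A : closed A -> measurable A.
Proof.
by move=> cA; rewrite -(setCK A); apply: measurableC; apply: open_measurable_rV;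
  exact: closed_openC.
Qed.

Lemma boundary_measurable_rV A : measurable (boundary A).
Proof.
apply: measurableD; first by apply: closed_measurable_rV; exact: closed_closure.
by apply: open_measurable_rV; exact: open_interior.
Qed.

Lemma continuous_measurable_rV (f : 'rV[R]_n -> R) :
  continuous f -> measurable_fun setT f.
Proof.
move=> /continuousP cf; apply: (measurability _ (RGenOpens.measurableE R)).
move=> _ [_ [a [b ->] <-]]; rewrite setTI; apply: open_measurable_rV.
exact/cf/interval_open.
Qed.

End borel_rV.

(** * Finiteness of Lebesgue measure on bounded sets *)

Section lebesgue_rV_bounded.
Context {R : realType}.

(** Stated coordinate by coordinate, so that splitting off the first coordinate leaves an interval
    times a lower-dimensional cube. *)
Definition cube n (M : R) : set 'rV[R]_n := [set x | forall i, `|x ord0 i| <= M].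

Lemma measurable_cube n M : measurable (cube n M).
Proof.
rewrite (_ : cube n M = \bigcap_(i in [set: 'I_n])
    (@rV_coord R n i @^-1` [set t | `|t| <= M])).
  apply: fin_bigcap_measurable => [|i _]; first exact: finite_finset.
  rewrite -[X in measurable X]setTI; apply: measurable_rV_coord => //.
  rewrite (_ : [set _ | _] = `[- M, M]%classic) //.
  by apply/seteqP; split => t /=; rewrite in_itv/= ler_norml.
by apply/seteqP; split => [x xM i _|x xM i]; exact: xM.
Qed.

(** Induction on the dimension: the base case is a Dirac mass, and the preimage of a cube under
    [rV_cons] lies in a product of an interval and a cube, both of finite measure. *)
Lemma lebesgue_rV_cube n M : (lebesgue_rV R n (cube n M) < +oo)%E.
Proof.
elim: n => [|n IHn] /=.
  by rewrite (le_lt_trans (probability_le1 _ _)) ?ltry//; exact: measurable_cube.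
rewrite /lebesgue_rV_succ /pushforward.
apply: (@le_lt_trans _ _
  ((@lebesgue_measure R \x^ lebesgue_rV R n)%E (`[- M, M]%classic `*` cube n M))).
  apply: le_measure.
  - rewrite inE -[X in measurable X]setTI.
    by apply: measurable_rV_cons => //; exact: measurable_cube.
  - by rewrite inE; apply: measurableX => //; exact: measurable_cube.
  - move=> [a x] /= Hax; split => [|i] /=.
      have -> : a = @rV_cons R n (a, x) ord0 (lshift n (ord0 : 'I_1)).
        by apply/esym/(etrans (row_mxEl _ _ _ _)); rewrite mxE eqxx mulr1n.
      by rewrite in_itv/= -ler_norml; exact: Hax.
    have -> : x ord0 i = @rV_cons R n (a, x) ord0 (rshift 1 i).
      by apply/esym; exact: row_mxEr.
    exact: Hax.
rewrite product_measure2E//; last exact: measurable_cube.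
apply: lte_mul_pinfty => //.
suff : @lebesgue_measure R `[- M, M]%classic \is a fin_num by [].
by rewrite lebesgue_measure_itv/=; case: ifPn.
Qed.

Lemma bounded_lebesgue_rV n (A : set 'rV[R]_n.+1) :
  measurable A -> bounded_set A -> (lebesgue_rV R n.+1 A < +oo)%E.
Proof.
move=> mA /ex_strict_bound_gt0[M M_gt0 AM].
apply: le_lt_trans (lebesgue_rV_cube n.+1 M); apply: le_measure.
- by rewrite inE.
- by rewrite inE; exact: measurable_cube.
- by move=> x /AM xM i; apply: le_trans (ltW xM); exact: ler_coord_norm.
Qed.

End lebesgue_rV_bounded.

(** * Integration against outer measures *)

Section outer_measure_integral.
Context d (T : measurableType d) (R : realType).
Variable mu : {outer_measure set T -> \bar R}.
Implicit Types (D : set T) (f g h : T -> R).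
Import HBNNSimple.
Local Open Scope ereal_scope.

Lemma outer_sintegral_term_ge0 (h : {nnsfun T >-> R}) (A : set T) x :
  0 <= x%:E * mu (h @^-1` [set x] `&` A).
Proof.
have [x_ge0|x_lt0] := leP 0%R x.
  by rewrite mule_ge0// outer_measure_ge0.
by rewrite preimage_nnfun0// set0I outer_measure0 mule0.
Qed.

(** The sum over all reals reduces to the finite range, since all other level sets are empty. *)
Lemma outer_sintegralE (h : {nnsfun T >-> R}) :
  sintegral mu h = \sum_(x \in range h) x%:E * mu (h @^-1` [set x]).
Proof.
rewrite /sintegral (fsbig_widen (range h) setT)//= => x [_ Nhx] /=.
by rewrite preimage10// outer_measure0 mule0.
Qed.

Lemma outer_sintegral0 : sintegral mu (cst 0%R) = 0.
Proof.
rewrite (outer_sintegralE (@nnsfun0 _ T R)) fsbig1// => _ [x _ <-].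
by rewrite mul0e.
Qed.

(** Multiplying [h] by the indicator of [A] cuts each nonzero level set down to [A]; only the level
    0 can grow, and its term vanishes. *)
Lemma outer_sintegral_proj (h : {nnsfun T >-> R}) A (mA : measurable A) :
  sintegral mu (proj_nnsfun h mA) =
  \sum_(x \in range h) x%:E * mu (h @^-1` [set x] `&` A).
Proof.
rewrite /sintegral (fsbig_widen (range h) setT)//=.
  apply: eq_fsbigr => x _; have [->|x_neq0] := eqVneq x 0%R; first by rewrite !mul0e.
  congr (_ * mu _); apply/seteqP; split => t /=; rewrite mindicE.
    have [|_] := boolP (t \in A); first by rewrite inE mulr1.
    by rewrite mulr0 => /esym/eqP; rewrite (negbTE x_neq0).
  by move=> [<- At]; rewrite mem_set// mulr1.
move=> x [_ Nhx] /=.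
by rewrite preimage10// set0I outer_measure0 mule0.
Qed.

(** Subadditivity on each level set, cut by [A] and its complement. An outer measure gives only this
    inequality, and it suffices below. *)
Lemma outer_sintegral_le_proj (h : {nnsfun T >-> R}) A (mA : measurable A)
    (mAC : measurable (~` A)) :
  sintegral mu h <=
  sintegral mu (proj_nnsfun h mA) + sintegral mu (proj_nnsfun h mAC).
Proof.
rewrite !outer_sintegral_proj outer_sintegralE.
rewrite -fsbig_split//=; apply: lee_fsum => // x [t _ <-].
rewrite -ge0_muleDr ?outer_measure_ge0//; apply: lee_wpmul2l.
  by rewrite lee_fin.
rewrite -[in leLHS](setIT (h @^-1` _)) -(setUv A) setIUr.
exact: outer_measureU2.
Qed.

Lemma outer_sintegralZ (k : R) (h : {nnsfun T >-> R}) : (0 < k)%R ->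
  sintegral mu (cst k \* h)%R = k%:E * sintegral mu h.
Proof.
move=> k_gt0; rewrite /sintegral ge0_mule_fsumr; last first.
  by move=> x; have := outer_sintegral_term_ge0 h setT x; rewrite setIT.
rewrite (reindex_fsbigT ( *%R k))/=; last first.
  by exists ( *%R k^-1); [apply: mulKf|apply: mulVKf]; rewrite gt_eqF.
apply: eq_fsbigr => x _; rewrite EFinM -muleA preimage_cstM ?gt_eqF//.
by rewrite mulrAC divff ?mul1r// gt_eqF.
Qed.

(** The integral is defined for any set function as a difference of two suprema; for nonnegative [f]
    the one for the negative part runs over the zero simple function only. *)
Lemma outer_ge0_integralE D f : (forall x, D x -> (0 <= f x)%R) ->
  \int[mu]_(x in D) (f x)%:E = ereal_sup [set sintegral mu h |
    h in [set h : {nnsfun T >-> R} | forall x, (h x)%:E <= ((EFin \o f) \_ D) x]].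
Proof.
move=> f_ge0; set g := (EFin \o f) \_ D.
have g_ge0 x : 0 <= g x.
  by rewrite /g patchE; case: ifPn => //; rewrite inE => /f_ge0; rewrite lee_fin.
have gposE : g^\+ = g.
  by apply/funext => x; rewrite (@ge0_funeposE _ _ setT)// inE.
have gnegE : g^\- = cst 0.
  by apply/funext => x; rewrite (@ge0_funenegE _ _ setT)// inE.
rewrite /integral -/g gposE gnegE [X in _ - X](_ : _ = 0) ?sube0//.
apply/eqP; rewrite eq_le; apply/andP; split; last first.
  by apply: ereal_sup_ubound; exists nnsfun0; [|exact: outer_sintegral0].
apply: ge_ereal_sup => _ [h /= h0 <-].
rewrite (eq_sintegral (cst 0%R)) ?outer_sintegral0// => x /=.
by apply/eqP; rewrite eq_le -!lee_fin h0 lee_fin fun_ge0.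
Qed.

Lemma outer_integral_ge0 D f : (forall x, D x -> (0 <= f x)%R) ->
  0 <= \int[mu]_(x in D) (f x)%:E.
Proof.
move=> f_ge0; rewrite outer_ge0_integralE//; apply: ereal_sup_ubound.
exists nnsfun0; last exact: outer_sintegral0.
by move=> x /=; rewrite patchE; case: ifPn => //; rewrite inE => /f_ge0.
Qed.

(* A simple function below [k * max(f, g)] splits along [{g <= f}] into one
   below [k * f] and one below [k * g]. *)
Lemma outer_integral_le_maxr D f g h (k : R) :
  measurable D -> measurable_fun D f -> measurable_fun D g -> (0 < k)%R ->
  (forall x, D x -> [/\ 0 <= f x, 0 <= g x, 0 <= h x &
                        h x <= k * Num.max (f x) (g x)]%R) ->
  \int[mu]_(x in D) (h x)%:E <=
  k%:E * (\int[mu]_(x in D) (f x)%:E + \int[mu]_(x in D) (g x)%:E).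
Proof.
move=> mD mf mg k_gt0 fgh.
have f_ge0 x : D x -> (0 <= f x)%R by case/fgh.
have g_ge0 x : D x -> (0 <= g x)%R by case/fgh.
rewrite ge0_muleDr ?outer_integral_ge0//.
rewrite !outer_ge0_integralE//; last by move=> x /fgh[].
apply: ge_ereal_sup => _ [s /= sh <-].
have mA : measurable (D `&` [set x | g x <= f x]%R).
  rewrite (_ : [set _ | _] = (fun x => g x <= f x)%R @^-1` [set true])//.
  exact: measurable_fun_ler.
rewrite (le_trans (outer_sintegral_le_proj s _ mA (measurableC mA)))//.
have s_le x : (s x <= if x \in D then h x else 0)%R.
  by have := sh x; rewrite patchE; case: ifP; rewrite /= lee_fin.
have proj_le A (mA' : measurable A) (w : T -> R) :
    (forall x, D x -> 0 <= w x)%R ->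
    (forall x, D x -> A x -> h x <= k * w x)%R ->
    sintegral mu (proj_nnsfun s mA') <=
    k%:E * ereal_sup [set sintegral mu h |
      h in [set h : {nnsfun T >-> R} | forall x, (h x)%:E <= ((EFin \o w) \_ D) x]].
  move=> w_ge0 hw; pose p := proj_nnsfun s mA'.
  have kV_ge0 : (0 <= k^-1)%R by rewrite invr_ge0 ltW.
  (* The projection is [k] times a simple function lying below [w], so the factor [k] can be taken
     out before comparing with the supremum. *)
  rewrite (eq_sintegral (cst k \* scale_nnsfun p kV_ge0)%R); last first.
    by move=> x /=; rewrite mulrA divff ?mul1r// gt_eqF.
  rewrite outer_sintegralZ// lee_pmul2l//; apply: ereal_sup_ubound.
  exists (scale_nnsfun p kV_ge0) => //= x; rewrite patchE mindicE.
  have := s_le x; case: ifPn => [/[!inE] Dx|_] s_le_x.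
    rewrite lee_fin ler_pdivrMl//.
    have [|_] := boolP (x \in A); last by rewrite mulr0 mulr_ge0 ?w_ge0// ltW.
    by rewrite inE => Ax; rewrite mulr1 (le_trans s_le_x)// hw.
  rewrite lee_fin (_ : s x = 0%R) ?mul0r ?mulr0//.
  by apply/eqP; rewrite eq_le s_le_x fun_ge0.
apply: leeD; apply: proj_le => x.
- by case/fgh.
- by move=> Dx [_ /= gf]; case: (fgh x Dx) => _ _ _; rewrite (max_idPl gf).
- by case/fgh.
- move=> Dx nA; case: (fgh x Dx) => _ _ _; rewrite (max_idPr _)//.
  by rewrite leNgt; apply: contra_notN nA => /ltW.
Qed.

End outer_measure_integral.

(** * Hausdorff measure, hence surface measure, as an outer measure *)

Section hausdorff_outer_measure.
Context (R : realType) (n : nat) (s : nat).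
Local Open Scope ereal_scope.

Lemma hausdorff_weight_ge0 (delta : R) (A : set 'rV[R]_n) :
  0 <= hausdorff_weight s delta A.
Proof.
rewrite /hausdorff_weight; case: ifPn => // /set0P[x Ax].
(* The supremum defining [diam] is [-oo] on the empty set; a point [x] gives the pair [(x, x)] and
   thus a nonnegative diameter. *)
case: ifPn => // _; apply: expe_ge0; apply: ereal_sup_ubound.
exists x => //; exists x => //; rewrite subrr /enorm big1 ?sqrtr0// => i _.
by rewrite mxE expr0n.
Qed.

Lemma hausdorff_weight0 (delta : R) : hausdorff_weight s delta (@set0 'rV[R]_n) = 0.
Proof. by rewrite /hausdorff_weight eqxx. Qed.

Let mu_ext_le_hausdorff (delta : R) (A : set 'rV[R]_n) : (0 < delta)%R ->
  mu_ext (hausdorff_weight s delta) A <= hausdorff s A.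
Proof. by move=> delta_gt0; apply: ereal_sup_ubound; exists delta. Qed.

Let hausdorff_ge0 (A : set 'rV[R]_n) : 0 <= hausdorff s A.
Proof.
apply: le_trans (mu_ext_le_hausdorff 1 A ltr01).
by apply: mu_ext_ge0 => B; exact: hausdorff_weight_ge0.
Qed.

Let hausdorff0 : hausdorff s (@set0 'rV[R]_n) = 0.
Proof.
apply/eqP; rewrite eq_le hausdorff_ge0 andbT; apply: ge_ereal_sup => _ [delta _ <-].
rewrite mu_ext0//; first exact: hausdorff_weight0.
by move=> B; exact: hausdorff_weight_ge0.
Qed.

Let le_hausdorff : {homo @hausdorff R n s : A B / A `<=` B >-> A <= B}.
Proof.
move=> A B AB; apply: ge_ereal_sup => _ [delta delta_gt0 <-].
apply: le_trans (mu_ext_le_hausdorff delta B delta_gt0).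
exact: le_mu_ext.
Qed.

(** Each [mu_ext] is countably subadditive and bounded by [hausdorff] term by term, so the bound
    survives the supremum over [delta]. *)
Let hausdorff_sigma_subadditive : sigma_subadditive (@hausdorff R n s).
Proof.
move=> F; apply: ge_ereal_sup => _ [delta delta_gt0 <-].
apply: le_trans.
  by apply: mu_ext_sigma_subadditive => B; exact: hausdorff_weight_ge0.
apply: lee_nneseries => [k _ _|k _]; last exact: mu_ext_le_hausdorff.
by apply: mu_ext_ge0 => B; exact: hausdorff_weight_ge0.
Qed.

HB.instance Definition _ := isOuterMeasure.Build R 'rV[R]_n (@hausdorff R n s)
  hausdorff0 hausdorff_ge0 le_hausdorff hausdorff_sigma_subadditive.

End hausdorff_outer_measure.

(** * Smooth and square-integrable functions *)

Section smooth_functions.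
Context {R : realType} {n : nat}.
Implicit Types phi psi : 'rV[R]_n -> R.

Lemma smooth_continuous phi : smooth phi -> continuous phi.
Proof. by move=> /(_ [::])[]. Qed.

Lemma smooth_partial_continuous phi i : smooth phi -> continuous (partial i phi).
Proof. by move=> /(_ [:: i])[]. Qed.

Lemma smooth_derivable phi i x : smooth phi -> derivable phi x (delta_mx ord0 i).
Proof. by move=> /(_ [::])[_]. Qed.

Lemma partialB phi psi i x :
  derivable phi x (delta_mx ord0 i) -> derivable psi x (delta_mx ord0 i) ->
  partial i (fun y => phi y - psi y) x = partial i phi x - partial i psi x.
Proof. exact: deriveB. Qed.

(** [smooth] speaks of all iterated partial derivatives, so subtraction has to commute with each of
    them; smoothness supplies the derivability needed at every induction step. *)
Lemma foldr_partialB phi psi s : smooth phi -> smooth psi ->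
  foldr (@partial R n) (fun x => phi x - psi x) s =
  (fun x => foldr (@partial R n) phi s x - foldr (@partial R n) psi s x).
Proof.
move=> sphi spsi; elim: s => [//|i s /= ->]; apply/funext => x.
by rewrite partialB//; [exact: (sphi s).2|exact: (spsi s).2].
Qed.

Lemma smoothB phi psi : smooth phi -> smooth psi -> smooth (fun x => phi x - psi x).
Proof.
move=> sphi spsi s; rewrite /= foldr_partialB//.
have [cphi dphi] := sphi s; have [cpsi dpsi] := spsi s.
split => [x|i x]; first exact: (continuousB (cphi x) (cpsi x)).
by apply: derivableB; [exact: dphi|exact: dpsi].
Qed.

Lemma gradB phi psi x : smooth phi -> smooth psi ->
  grad (fun y => phi y - psi y) x = grad phi x - grad psi x.
Proof.
by move=> sphi spsi; apply/rowP => i; rewrite !mxE partialB//; exact: smooth_derivable.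
Qed.

Lemma measurable_grad (D : set 'rV[R]_n) phi i : smooth phi ->
  measurable_fun D (fun x => grad phi x ord0 i).
Proof.
move=> sphi; under eq_fun do rewrite mxE.
apply: measurable_funTS; apply: continuous_measurable_rV.
exact: smooth_partial_continuous.
Qed.

Lemma enorm_sqr (x : 'rV[R]_n) : enorm x ^+ 2 = \sum_(i < n) x ord0 i ^+ 2.
Proof. by rewrite sqr_sqrtr// sumr_ge0// => i _; exact: sqr_ge0. Qed.

Lemma measurable_enorm_sqr (D : set 'rV[R]_n) (F : 'rV[R]_n -> 'rV[R]_n) :
  (forall i, measurable_fun D (fun x => F x ord0 i)) ->
  measurable_fun D (fun x => enorm (F x) ^+ 2).
Proof.
move=> mF; under eq_fun do rewrite enorm_sqr.
by apply: measurable_sum => i; exact: measurable_funX.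
Qed.

(** In each coordinate the two sides differ by the square of the sum. *)
Lemma enorm_sqrB_le (x y : 'rV[R]_n) :
  enorm (x - y) ^+ 2 <= 2 * (enorm x ^+ 2 + enorm y ^+ 2).
Proof.
rewrite !enorm_sqr -big_split/= mulr_sumr; apply: ler_sum => i _.
rewrite !mxE -subr_ge0 (_ : _ - _ = (x ord0 i + y ord0 i) ^+ 2) ?sqr_ge0//.
ring.
Qed.

End smooth_functions.

(** * Products and differences of square-integrable functions *)

Section square_integrable.
Context {R : realType} {n : nat}.
Local Notation leb := (lebesgue_rV R n).
Variable D : set 'rV[R]_n.
Hypothesis mD : measurable D.
Implicit Types u v : 'rV[R]_n -> R.

(** Domination by [u ^+ 2 + v ^+ 2]. *)
Lemma L2_integrableM u v : L2 D u -> L2 D v ->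
  leb.-integrable D (fun x => (u x * v x)%:E).
Proof.
move=> [mu iu] [mv iv].
apply: le_integrable (integrableD mD iu iv) => //.
  exact/measurable_EFinP/measurable_funM.
move=> x Dx /=; rewrite lee_fin [leRHS]ger0_norm ?addr_ge0 ?sqr_ge0//.
by rewrite ler_norml; nra.
Qed.

Lemma L2B u v : L2 D u -> L2 D v -> L2 D (fun x => u x - v x).
Proof.
move=> Lu Lv; have [mu iu] := Lu; have [mv iv] := Lv.
split; first exact: measurable_funB.
have := integrableB mD (integrableD mD iu iv) (integrableZl mD 2 (L2_integrableM u v Lu Lv)).
apply: eq_integrable => // x _ /=.
by rewrite -!EFinD; congr EFin; ring.
Qed.

Lemma bounded_L2 u (M : R) : (leb D < +oo)%E -> measurable_fun D u ->
  (forall x, D x -> `|u x| <= M) -> L2 D u.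
Proof.
move=> Doo mu uM; split => //.
apply: (@le_integrable _ _ _ _ _ mD _ (cst (M ^+ 2)%:E)).
- exact/measurable_EFinP/measurable_funX.
- move=> x Dx /=; rewrite lee_fin !ger0_norm ?sqr_ge0//.
  by rewrite -(ger0_norm (sqr_ge0 (u x))) normrX lerXn2r ?nnegrE ?uM// (le_trans _ (uM x Dx)).
- apply/integrableP; split; first exact: measurable_cst.
  by rewrite /= integral_cst// lte_mul_pinfty// abse_ge0.
Qed.

Lemma L2_bounded_integrableM u v (M : R) : (leb D < +oo)%E -> L2 D u ->
  measurable_fun D v -> (forall x, D x -> `|v x| <= M) ->
  leb.-integrable D (fun x => (u x * v x)%:E).
Proof. by move=> Doo Lu mv vM; apply: L2_integrableM => //; exact: bounded_L2 vM. Qed.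

Lemma L2norm_sqr u : L2norm D u ^+ 2 = (\int[leb]_(x in D) (u x ^+ 2))%R.
Proof. by rewrite sqr_sqrtr// Rintegral_ge0// => x _; exact: sqr_ge0. Qed.

End square_integrable.

(** * Closure of H^1 and of the trace under subtraction *)

(** [D] need not be closed, but it lies in a closed cube, which is compact. *)
Lemma continuous_bounded_on {R : realType} {n : nat} (D : set 'rV[R]_n)
    (f : 'rV[R]_n -> R) : bounded_set D -> continuous f ->
  exists M, forall x, D x -> `|f x| <= M.
Proof.
move=> /ex_strict_bound_gt0[M M_gt0 DM] cf.
have ccube : compact [set x : 'rV[R]_n | forall i, `[- M, M]%classic (x ord0 i)].
  by apply: (@rV_compact _ _ (fun=> `[- M, M]%classic)) => i; exact: segment_compact.
have cfcube := continuous_compact (continuous_subspaceT cf) ccube.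
have /ex_strict_bound_gt0[N _ fN] := compact_bounded cfcube.
exists N => x Dx; apply/ltW/fN; exists x => // i /=.
by rewrite in_itv/= -ler_norml; apply: le_trans (ltW (DM x Dx)); exact: ler_coord_norm.
Qed.

Lemma cvge0_le {R : realType} (a b c : nat -> \bar R) (k : R) :
  (forall i, 0 <= c i)%E -> (forall i, c i <= k%:E * (a i + b i))%E ->
  a i @[i --> \oo] --> 0%E -> b i @[i --> \oo] --> 0%E ->
  c i @[i --> \oo] --> 0%E.
Proof.
move=> c_ge0 c_le a0 b0.
apply: (@squeeze_cvge _ _ _ _ (cst 0%E) c (fun i => k%:E * (a i + b i))%E).
- by apply: nearW => i; rewrite c_ge0 c_le.
- exact: cvg_cst.
- rewrite -[X in _ --> X](mule0 k%:E) -[X in (_ * X)%E](adde0 0%E).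
  by apply: cvgeZl => //; exact: cvgeD.
Qed.

Lemma sqrB_le_max {R : realFieldType} (a b : R) :
  (a - b) ^+ 2 <= 4 * Num.max (a ^+ 2) (b ^+ 2).
Proof.
have ab_ge0 := sqr_ge0 (a + b).
by case: (leP (a ^+ 2) (b ^+ 2)) => ?; lra.
Qed.

(** The counterpart of [outer_integral_le_maxr] for a true measure, where additivity allows the sum
    in place of the maximum. *)
Lemma ge0_integral_le_add d (X : measurableType d) {R : realType}
    (mu : {measure set X -> \bar R}) (D : set X) (f g h : X -> R) (k : R) :
  measurable D -> measurable_fun D f -> measurable_fun D g ->
  measurable_fun D h -> 0 <= k ->
  (forall x, D x -> [/\ 0 <= f x, 0 <= g x, 0 <= h x & h x <= k * (f x + g x)]) ->
  (\int[mu]_(x in D) (h x)%:E <=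
   k%:E * (\int[mu]_(x in D) (f x)%:E + \int[mu]_(x in D) (g x)%:E))%E.
Proof.
move=> mD mf mg mh k_ge0 fgh.
have f_ge0 x : D x -> (0 <= (f x)%:E)%E by move=> /fgh[].
have g_ge0 x : D x -> (0 <= (g x)%:E)%E by move=> /fgh[].
have mf' : measurable_fun D (EFin \o f) by exact/measurable_EFinP.
have mg' : measurable_fun D (EFin \o g) by exact/measurable_EFinP.
rewrite -ge0_integralD// -ge0_integralZl//.
- apply: ge0_le_integral => //.
  + by move=> x /fgh[].
  + exact/measurable_EFinP.
  + by apply: measurable_funeM; exact: emeasurable_funD.
  + by move=> x /fgh[].
- exact: emeasurable_funD.
- by move=> x Dx; rewrite adde_ge0// ?f_ge0 ?g_ge0.
Qed.

Section H1_sub.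
Context {R : realType} {n : nat}.
Local Notation T := 'rV[R]_n.+1.
Local Notation leb := (lebesgue_rV R n.+1).
Local Notation sigma := (@surface R n.+1).
Variable Omega : set T.
Hypotheses (oOmega : open Omega) (bOmega : bounded_set Omega).
Implicit Types (Gamma : set T) (u v w f g : T -> R) (Du Dv : T -> T).

Let mOmega : measurable Omega := open_measurable_rV Omega oOmega.

(** Applied to test functions and their partial derivatives, to split the integrals that define the
    weak gradient. *)
Lemma L2_continuous_integrableM u f : L2 Omega u -> continuous f ->
  leb.-integrable Omega (fun x => (u x * f x)%:E).
Proof.
move=> Lu cf; have [M fM] := continuous_bounded_on Omega f bOmega cf.
apply: (L2_bounded_integrableM _ _ _ _ M) => //.
- exact: bounded_lebesgue_rV.
- by apply: measurable_funTS; exact: continuous_measurable_rV.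
Qed.

Lemma weak_gradientB u v Du Dv : H1 Omega u Du -> H1 Omega v Dv ->
  weak_gradient Omega (fun x => u x - v x) (fun x => Du x - Dv x).
Proof.
move=> [Lu LDu wu] [Lv LDv wv] phi tphi i.
have sphi := tphi.1.
have cphi := smooth_continuous _ sphi.
have cdphi := smooth_partial_continuous _ i sphi.
under eq_Rintegral do rewrite mulrBl.
rewrite RintegralB//; [|exact: L2_continuous_integrableM..].
under [in RHS]eq_Rintegral do rewrite !mxE mulrBl.
rewrite RintegralB//; [|exact: L2_continuous_integrableM..].
by rewrite wu// wv// opprB opprK addrC.
Qed.

Lemma H1B u v Du Dv : H1 Omega u Du -> H1 Omega v Dv ->
  H1 Omega (fun x => u x - v x) (fun x => Du x - Dv x).
Proof.
move=> Hu Hv; split; last exact: weak_gradientB.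
- by apply: L2B => //; [case: Hu|case: Hv].
- move=> i; under eq_fun do rewrite !mxE.
  by apply: L2B => //; [case: Hu|case: Hv].
Qed.

Lemma measurable_H1_distance phi u Du : smooth phi -> H1 Omega u Du ->
  measurable_fun Omega
    (fun x => (phi x - u x) ^+ 2 + enorm (grad phi x - Du x) ^+ 2).
Proof.
move=> sphi [[mu _] LDu _]; apply: measurable_funD.
  apply: measurable_funX; apply: measurable_funB => //.
  by apply: measurable_funTS; apply: continuous_measurable_rV; exact: smooth_continuous.
apply: measurable_enorm_sqr => i.
rewrite (_ : (fun _ => _) = (fun x => grad phi x ord0 i - Du x ord0 i)); last first.
  by apply/funext => x; rewrite !mxE.
by apply: measurable_funB; [exact: measurable_grad|case: (LDu i)].
Qed.

(** The differences of the two approximating sequences approximate the difference, both inside the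
    domain and on its boundary. *)
Lemma is_traceB u v Du Dv w w' : H1 Omega u Du -> H1 Omega v Dv ->
  is_trace Omega u Du w -> is_trace Omega v Dv w' ->
  is_trace Omega (fun x => u x - v x) (fun x => Du x - Dv x) (fun x => w x - w' x).
Proof.
move=> Hu Hv.
move=> [mw w_fin [phi [sphi phi_u phi_w]]] [mw' w'_fin [psi [spsi psi_v psi_w']]].
have mB : measurable (boundary Omega) := boundary_measurable_rV Omega.
split; first exact: measurable_funB.
  apply: (@le_lt_trans _ _ (4%:E * (\int[sigma]_(x in boundary Omega) (w x ^+ 2)%:E +
      \int[sigma]_(x in boundary Omega) (w' x ^+ 2)%:E))%E).
    apply: outer_integral_le_maxr => //; try exact: measurable_funX.
    by move=> x _; split; rewrite ?sqr_ge0// sqrB_le_max.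
  by rewrite lte_mul_pinfty// lte_add_pinfty.
exists (fun k x => phi k x - psi k x); split.
- by move=> k; exact: (smoothB _ _ (sphi k) (spsi k)).
(* Inside the domain the factor 2 comes from [(a - b)^2 <= 2 (a^2 + b^2)], for values and gradients
   alike. *)
- apply: (cvge0_le _ _ _ 2 _ _ phi_u psi_v) => k.
    by apply: integral_ge0 => x _; rewrite lee_fin addr_ge0// sqr_ge0.
  apply: ge0_integral_le_add => //.
  + exact: measurable_H1_distance.
  + exact: measurable_H1_distance.
  + apply: measurable_H1_distance; first exact: (smoothB _ _ (sphi k) (spsi k)).
    exact: H1B.
  + move=> x _; split; rewrite ?addr_ge0 ?sqr_ge0//.
    have -> : phi k x - psi k x - (u x - v x) =
              (phi k x - u x) - (psi k x - v x) by ring.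
    have -> : grad (fun y => phi k y - psi k y) x - (Du x - Dv x) =
              (grad (phi k) x - Du x) - (grad (psi k) x - Dv x).
      by rewrite gradB//; apply/rowP => i; rewrite !mxE; ring.
    have := enorm_sqrB_le (grad (phi k) x - Du x) (grad (psi k) x - Dv x).
    have := sqr_ge0 ((phi k x - u x) + (psi k x - v x)).
    lra.
(* On the boundary the factor 4 comes from [sqrB_le_max]. *)
- apply: (cvge0_le _ _ _ 4 _ _ phi_w psi_w') => k.
    by apply: outer_integral_ge0 => x _; exact: sqr_ge0.
  have mcont f : smooth f -> measurable_fun (boundary Omega) f.
    move=> sf; apply: measurable_funTS; apply: continuous_measurable_rV.
    exact: smooth_continuous.
  apply: outer_integral_le_maxr => //.
  + by apply: measurable_funX; apply: measurable_funB => //; exact: mcont.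
  + by apply: measurable_funX; apply: measurable_funB => //; exact: mcont.
  + move=> x _; split; rewrite ?sqr_ge0//.
    rewrite (_ : _ - _ - _ = (phi k x - w x) - (psi k x - w' x)) ?sqrB_le_max//.
    ring.
Qed.

Lemma trace_eqB Gamma u v Du Dv f g : H1 Omega u Du -> H1 Omega v Dv ->
  trace_eq Omega Gamma u Du f -> trace_eq Omega Gamma v Dv g ->
  trace_eq Omega Gamma (fun x => u x - v x) (fun x => Du x - Dv x)
    (fun x => f x - g x).
Proof.
move=> Hu Hv [w tw [N [mN N0 wN]]] [w' tw' [N' [mN' N'0 w'N']]].
exists (fun x => w x - w' x); first exact: is_traceB.
exists (N `|` N'); split; first exact: measurableU.
  (* A union of two null sets is null by subadditivity alone. *)
  have NN' : (sigma (N `|` N') <= sigma N + sigma N')%E by exact: outer_measureU2.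
  rewrite N0 N'0 adde0 in NN'.
  by apply/eqP; rewrite eq_le NN'/=; exact: outer_measure_ge0.
apply: subset_trans (setUSS wN w'N').
move=> x /= nwf; apply/not_andP => -[wf w'g]; apply: nwf.
by move=> Gx; rewrite wf// w'g.
Qed.

Lemma V0B Gamma u v Du Dv : V0 Omega Gamma u Du -> V0 Omega Gamma v Dv ->
  V0 Omega Gamma (fun x => u x - v x) (fun x => Du x - Dv x).
Proof.
move=> [Hu tu] [Hv tv]; split; first exact: H1B.
rewrite (_ : cst 0 = (fun x : T => cst 0 x - cst 0 x)); last first.
  by apply/funext => x /=; rewrite subr0.
exact: (trace_eqB Gamma _ _ _ _ _ _ Hu Hv tu tv).
Qed.

End H1_sub.

(** * Energy estimate *)

Lemma sinh_monotone {R : realType} (x y : R) : x <= y -> sinh x <= sinh y.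
Proof.
move=> xy; rewrite /sinh ler_pM2r ?invr_gt0// lerB ?ler_expR//.
by rewrite lerN2.
Qed.

Lemma sinhB_mulB_ge0 {R : realType} (x y : R) : 0 <= (sinh x - sinh y) * (x - y).
Proof.
have [xy|/ltW yx] := leP x y.
  by rewrite mulr_le0// subr_le0// sinh_monotone.
by rewrite mulr_ge0// subr_ge0// sinh_monotone.
Qed.

Section energy.
Context {R : realType} {n : nat}.
Local Notation T := 'rV[R]_n.+1.
Local Notation leb := (lebesgue_rV R n.+1).
Variable D : set T.
Hypothesis mD : measurable D.
Implicit Types (u v c eps : T -> R) (F G : T -> T).

Lemma L2_integrable_dot F G : (forall i, L2 D (fun x => F x ord0 i)) ->
  (forall i, L2 D (fun x => G x ord0 i)) ->
  leb.-integrable D (fun x => (dot (F x) (G x))%:E).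
Proof.
move=> LF LG; rewrite /dot; under eq_fun do rewrite -sumEFin.
by apply: integrable_sum => // i _; exact: L2_integrableM.
Qed.

Lemma bounded_integrableM eps f (a b : R) : measurable_fun D eps ->
  (forall x, a <= eps x <= b) -> 0 <= a ->
  leb.-integrable D (fun x => (f x)%:E) ->
  leb.-integrable D (fun x => (eps x * f x)%:E).
Proof.
move=> meps eps_ab a_ge0 If.
have mf : measurable_fun D f by apply/measurable_EFinP; exact: measurable_int If.
apply: le_integrable (integrableZl mD b If) => //.
  exact/measurable_EFinP/measurable_funM.
move=> x Dx /=; rewrite lee_fin !normrM ler_wpM2r//.
have /andP[ax xb] := eps_ab x.
by rewrite !ger0_norm//; lra.
Qed.

Lemma vL2norm_sqr F : vL2norm D F ^+ 2 = (\int[leb]_(x in D) dot (F x) (F x))%R.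
Proof.
rewrite /vL2norm L2norm_sqr; apply: eq_Rintegral => x _.
by rewrite enorm_sqr; apply: eq_bigr => i _; rewrite expr2.
Qed.

(** Integrates the pointwise Young inequality, in which the gap is [(s * c x - v x)^2 / (2 * s)].
    The weight [s] stays free for the later absorption. *)
Lemma L2norm_Young c v (s : R) : 0 < s -> L2 D c -> L2 D v ->
  (\int[leb]_(x in D) (c x * v x))%R <=
    s / 2 * L2norm D c ^+ 2 + s^-1 / 2 * L2norm D v ^+ 2.
Proof.
move=> s_gt0 Lc Lv.
have Ic : leb.-integrable D (EFin \o (fun x => s / 2 * c x ^+ 2)).
  exact: (integrableZl mD (s / 2) Lc.2).
have Iv : leb.-integrable D (EFin \o (fun x => s^-1 / 2 * v x ^+ 2)).
  exact: (integrableZl mD (s^-1 / 2) Lv.2).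
rewrite !L2norm_sqr -RintegralZl//; last exact: Lc.2.
rewrite -RintegralZl//; last exact: Lv.2.
rewrite -RintegralD//; apply: le_Rintegral => //.
- exact: L2_integrableM.
- by have := integrableD mD Ic Iv.
move=> x _.
rewrite -subr_ge0 (_ : _ - _ = (2 * s)^-1 * (s * c x - v x) ^+ 2).
  by rewrite mulr_ge0 ?sqr_ge0// invr_ge0 mulr_ge0// ltW.
by field; rewrite gt_eqF.
Qed.

(** Starts from the two equations already tested with [v], and from bounds on [eps] at every point;
    almost-everywhere bounds are reduced to this case by [ae_eq_RintegralM]. *)
Lemma energy_inequality (eps : T -> R) (eps0 b k : R)
    c1 c2 u1 u2 (Du1 Du2 : T -> T) (v := fun x => u1 x - u2 x)
    (Dv := fun x => Du1 x - Du2 x) :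
  0 < eps0 -> measurable_fun D eps -> (forall x, eps0 <= eps x <= b) -> 0 <= k ->
  L2 D c1 -> L2 D c2 -> L2 D v ->
  (forall i, L2 D (fun x => Du1 x ord0 i)) ->
  (forall i, L2 D (fun x => Du2 x ord0 i)) ->
  leb.-integrable D (fun x => (sinh (u1 x) * v x)%:E) ->
  leb.-integrable D (fun x => (sinh (u2 x) * v x)%:E) ->
  (\int[leb]_(x in D) (eps x * dot (Du1 x) (Dv x)) +
    k * \int[leb]_(x in D) (sinh (u1 x) * v x) =
    \int[leb]_(x in D) (c1 x * v x))%R ->
  (\int[leb]_(x in D) (eps x * dot (Du2 x) (Dv x)) +
    k * \int[leb]_(x in D) (sinh (u2 x) * v x) =
    \int[leb]_(x in D) (c2 x * v x))%R ->
  eps0 * vL2norm D Dv ^+ 2 <= (\int[leb]_(x in D) ((c1 x - c2 x) * v x))%R.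
Proof.
move=> eps0_gt0 meps eps_ab k_ge0 Lc1 Lc2 Lv LDu1 LDu2 Is1 Is2 eq1 eq2.
have LDv i : L2 D (fun x => Dv x ord0 i).
  by under eq_fun do rewrite !mxE; exact: L2B.
have IDv := L2_integrable_dot _ _ LDv LDv.
have Ieps F : (forall i, L2 D (fun x => F x ord0 i)) ->
    leb.-integrable D (fun x => (eps x * dot (F x) (Dv x))%:E).
  move=> LF; apply: (bounded_integrableM _ _ _ _ meps eps_ab (ltW eps0_gt0)).
  exact: L2_integrable_dot.
(* The difference of the two equations, as an exact identity; the estimates come only afterwards. *)
have -> : (\int[leb]_(x in D) ((c1 x - c2 x) * v x))%R =
    (\int[leb]_(x in D) (eps x * dot (Dv x) (Dv x)))%R +
    k * (\int[leb]_(x in D) ((sinh (u1 x) - sinh (u2 x)) * v x))%R.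
  under eq_Rintegral do rewrite mulrBl.
  rewrite RintegralB//; [|exact: L2_integrableM..].
  under [X in _ + k * X]eq_Rintegral do rewrite mulrBl.
  rewrite RintegralB// -eq1 -eq2.
  under [X in _ = X + _]eq_Rintegral => x _.
    rewrite (_ : eps x * dot (Dv x) (Dv x) =
      eps x * dot (Du1 x) (Dv x) - eps x * dot (Du2 x) (Dv x)); last first.
      rewrite -mulrBr -sumrB; congr (_ * _); apply: eq_bigr => i _.
      by rewrite -mulrBl !mxE.
    over.
  rewrite RintegralB//; [|exact: Ieps..].
  by rewrite mulrBr opprD addrACA.
apply: le_trans (_ : (\int[leb]_(x in D) (eps x * dot (Dv x) (Dv x)))%R <= _).
  rewrite vL2norm_sqr -RintegralZl//; apply: le_Rintegral => //.
  - exact: (integrableZl mD eps0 IDv).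
  - exact: Ieps.
  - move=> x _; have /andP[ax _] := eps_ab x.
    by rewrite ler_wpM2r//; apply: sumr_ge0 => i _; rewrite -expr2 sqr_ge0.
(* The [sinh] term is dropped because its integrand is nonnegative. *)
rewrite lerDl mulr_ge0// Rintegral_ge0// => x _; exact: sinhB_mulB_ge0.
Qed.

Lemma ae_eq_RintegralM eps eps' f :
  measurable_fun D eps -> measurable_fun D eps' -> measurable_fun D f ->
  {ae leb, forall x, D x -> eps x = eps' x} ->
  (\int[leb]_(x in D) (eps x * f x) = \int[leb]_(x in D) (eps' x * f x))%R.
Proof.
move=> meps meps' mf epsE; congr fine; apply: ae_eq_integral => //.
- exact/measurable_EFinP/measurable_funM.
- exact/measurable_EFinP/measurable_funM.
- by apply: filterS epsE => x xE Dx; rewrite xE.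
Qed.

End energy.

(* The hypothesis on [e * X^2] is Young's inequality with [s = K^2 / e], chosen
   so that half of [e * X^2] can be absorbed. *)
Lemma energy_bound {R : realFieldType} (e K C V X : R) :
  0 < e -> 1 <= K -> 0 <= C -> 0 <= V -> 0 <= X -> V <= K * X ->
  e * X ^+ 2 <= K ^+ 2 / e / 2 * C ^+ 2 + (K ^+ 2 / e)^-1 / 2 * V ^+ 2 ->
  V ^+ 2 + X ^+ 2 <= (2 * K ^+ 2 / e * C) ^+ 2.
Proof.
move=> e_gt0 K_ge1 C_ge0 V_ge0 X_ge0 VX eX.
have K_gt0 : 0 < K by lra.
have V2 : V ^+ 2 <= K ^+ 2 * X ^+ 2 by rewrite -exprMn lerXn2r ?nnegrE ?mulr_ge0 ?(ltW K_gt0).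
(* The [V] term is at most [e / 2 * X ^+ 2]; absorbing it on the left and multiplying by [2 / e]
   isolates [X ^+ 2]. *)
have eX2 : X ^+ 2 <= (K / e * C) ^+ 2.
  have : (K ^+ 2 / e)^-1 / 2 * V ^+ 2 <= e / 2 * X ^+ 2.
    rewrite (_ : e / 2 * X ^+ 2 = (K ^+ 2 / e)^-1 / 2 * (K ^+ 2 * X ^+ 2)).
      by rewrite ler_wpM2l// divr_ge0// invr_ge0 divr_ge0 ?sqr_ge0 ?ltW.
    by field; rewrite !gt_eqF.
  have -> : (K / e * C) ^+ 2 = (2 / e) * (K ^+ 2 / e / 2 * C ^+ 2).
    by field; rewrite gt_eqF.
  move=> H; rewrite mulrAC ler_pdivlMr// mulrC; lra.
have K2 : 1 <= K ^+ 2 by rewrite exprn_ege1.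
have -> : (2 * K ^+ 2 / e * C) ^+ 2 = (4 * K ^+ 2) * (K / e * C) ^+ 2.
  by field; rewrite gt_eqF.
(* Since [1 <= K], the left side is at most [(K ^+ 2 + 1) * X ^+ 2], hence at most
   [2 * K ^+ 2 * X ^+ 2]; the larger factor 4 makes the bound a perfect square. *)
apply: (@le_trans _ _ ((4 * K ^+ 2) * X ^+ 2)); last first.
  by rewrite ler_wpM2l// mulr_ge0 ?sqr_ge0.
have := sqr_ge0 X; nra.
Qed.

Theorem theorem2 (R : realType) :
  exists eta : R -> R -> R,
  forall (d : nat) (d_le3 : (d.+1 <= 3)%N)
    (Omega : set 'rV[R]_d.+1) (Omega_dom : bounded_lipschitz_domain Omega)
    (dOmega1 dOmega2 dOmega3 : set 'rV[R]_d.+1)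
    (boundaryE : boundary Omega = dOmega1 `|` dOmega2 `|` dOmega3)
    (delta : R) (delta_gt0 : 0 < delta)
    (eps0 eps1 : R) (eps : 'rV[R]_d.+1 -> R)
    (eps0_gt0 : 0 < eps0)
    (eps_meas : measurable_fun Omega eps)
    (eps_bounds : {ae lebesgue_rV R d.+1,
                    forall x, Omega x -> eps0 <= eps x <= eps1})
    (kP : R) (kP_poincare : poincare_constant Omega (dOmega2 `|` dOmega3) kP)
    (f1 f2 : 'rV[R]_d.+1 -> R)
    (g : 'rV[R]_d.+1 -> R) (Dg : 'rV[R]_d.+1 -> 'rV[R]_d.+1)
    (g_H1 : H1 Omega g Dg)
    (g_f1 : trace_eq Omega dOmega2 g Dg f1)
    (g_f2 : trace_eq Omega dOmega3 g Dg f2)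
    (c1 c2 : 'rV[R]_d.+1 -> R) (c1_L2 : L2 Omega c1) (c2_L2 : L2 Omega c2)
    (u1 u2 : 'rV[R]_d.+1 -> R) (Du1 Du2 : 'rV[R]_d.+1 -> 'rV[R]_d.+1),
  weak_solution Omega (dOmega2 `|` dOmega3) eps delta g Dg c1 u1 Du1 ->
  weak_solution Omega (dOmega2 `|` dOmega3) eps delta g Dg c2 u2 Du2 ->
  H1norm Omega (fun x => u1 x - u2 x) (fun x => Du1 x - Du2 x)
    <= eta eps0 kP * L2norm Omega (fun x => c1 x - c2 x).
Proof.
(* [|kP| + 1] rather than [kP], since nothing is assumed on the sign of [kP]. *)
exists (fun eps0 kP => 2 * (`|kP| + 1) ^+ 2 / eps0).
move=> d _ Omega [_ oOmega _ bOmega _] _ dOmega2 dOmega3 _ delta delta_gt0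
  eps0 eps1 eps eps0_gt0 eps_meas eps_bounds kP kP_poincare _ _ g Dg _ _ _
  c1 c2 c1_L2 c2_L2 u1 u2 Du1 Du2 [u1_H1 u1_V0 u1_eq] [u2_H1 u2_V0 u2_eq].
have mOmega : measurable Omega := open_measurable_rV Omega oOmega.
set v := fun x => u1 x - u2 x; set Dv := fun x => Du1 x - Du2 x.
(* The lifting cancels: [v] is the difference of [u1 - g] and [u2 - g], both in [V0]. *)
have v_V0 : V0 Omega (dOmega2 `|` dOmega3) v Dv.
  have := V0B Omega oOmega bOmega _ _ _ _ _ u1_V0 u2_V0.
  rewrite (_ : (fun x => u1 x - g x - (u2 x - g x)) = v); last first.
    by apply/funext => x; rewrite /v; ring.
  rewrite (_ : (fun x => Du1 x - Dg x - (Du2 x - Dg x)) = Dv)//.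
  by apply/funext => x; apply/rowP => i; rewrite /Dv !mxE; ring.
have [[v_L2 Dv_L2 _] _] := v_V0.
have [_ Du1_L2 _] := u1_H1; have [_ Du2_L2 _] := u2_H1.
have c_L2 := L2B _ mOmega _ _ c1_L2 c2_L2.
(* [eps] satisfies its bounds only almost everywhere; [eps'] does everywhere. *)
pose eps' x := Num.max eps0 (Num.min eps1 (eps x)).
have eps'_meas : measurable_fun Omega eps'.
  by apply: measurable_maxr => //; exact: measurable_minr.
have epsE : {ae lebesgue_rV R d.+1, forall x, Omega x -> eps x = eps' x}.
  apply: filterS eps_bounds => x epsx /epsx/andP[x0 x1].
  by rewrite /eps' (min_idPr x1) (max_idPr x0).
(* The upper bound is a maximum because [eps0 <= eps1] is not among the hypotheses. *)
have eps'_bounds x : eps0 <= eps' x <= Num.max eps0 eps1.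
  rewrite /eps' le_max lexx/= ge_max; apply/andP; split; first by rewrite le_max lexx.
  by rewrite le_max !ge_min lexx orbT.
have mdot (F : 'rV[R]_d.+1 -> 'rV[R]_d.+1) : (forall i, L2 Omega (fun x => F x ord0 i)) ->
    measurable_fun Omega (fun x => dot (F x) (Dv x)).
  move=> F_L2; apply/measurable_EFinP; apply: (measurable_int (lebesgue_rV R d.+1)).
  exact: L2_integrable_dot.
have [Is1] := u1_eq _ _ v_V0; rewrite (ae_eq_RintegralM _ mOmega _ eps')//; last exact: mdot.
move=> eq1.
have [Is2] := u2_eq _ _ v_V0; rewrite (ae_eq_RintegralM _ mOmega _ eps')//; last exact: mdot.
move=> eq2.
have energy : eps0 * vL2norm Omega Dv ^+ 2 <=
    (\int[lebesgue_rV R d.+1]_(x in Omega) ((c1 x - c2 x) * v x))%R.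
  apply: (energy_inequality _ mOmega eps' _ _ (2 * delta ^+ 2) _ _ u1 u2 _ _
    eps0_gt0 eps'_meas eps'_bounds _ c1_L2 c2_L2 v_L2 Du1_L2 Du2_L2 Is1 Is2 eq1 eq2).
  by rewrite mulr_ge0 ?sqr_ge0.
set K := `|kP| + 1.
have K_ge1 : 1 <= K by rewrite lerDr.
have s_gt0 : 0 < K ^+ 2 / eps0 by rewrite divr_gt0// exprn_gt0// (lt_le_trans ltr01).
have young := L2norm_Young _ mOmega _ _ _ s_gt0 c_L2 v_L2.
have poincare : L2norm Omega v <= K * vL2norm Omega Dv.
  apply: le_trans (kP_poincare _ _ v_V0) _; rewrite ler_wpM2r ?sqrtr_ge0//.
  by rewrite (le_trans (ler_norm _))// lerDl.
(* The right side is nonnegative, so it is the root of its square, and comparing the squares is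
   enough. *)
rewrite /H1norm -[leRHS]ger0_norm; last first.
  apply: mulr_ge0; last exact: sqrtr_ge0.
  by rewrite divr_ge0 ?(ltW eps0_gt0)// mulr_ge0// sqr_ge0.
rewrite -sqrtr_sqr ler_wsqrtr//.
apply: energy_bound => //; try exact: sqrtr_ge0.
exact: le_trans energy young.
Qed.
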